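(* Let $k\ge 3$. There exist integers $N$ and $n_0$ (depending on $k$) such that for every field $\mathbb{F}$ with $|\mathbb{F}|\ge N$ and every $n\ge n_0$ we have the strict inequality $\mathrm{R}(W_k^{\otimes n})<\mathrm{R}(W_k)^n$. For example, for all fields $\mathbb{F}$ of sufficiently large (possibly infinite) cardinality, $\mathrm{R}(W_3^{\otimes 7})<\mathrm{R}(W_3)^7$ and $\mathrm{R}(W_8^{\otimes 2})<\mathrm{R}(W_8)^2$.
   Context: Let $b_1,b_2$ be the standard basis of $\mathbb{F}^2$. For $k\ge 3$, $W_k\in(\mathbb{F}^2)^{\otimes k}$ is the $k$-tensor $W_k=\sum b_{i_1}\otimes\cdots\otimes b_{i_k}$, where the sum is over all $i\in\{1,2\}^k$ that are permutations of $(1,1,\dots,1,2)$ (exactly one entry equals 2). The tensor rank $\mathrm{R}(t)$ of a $k$-tensor $t\in U_1\otimes\cdots\otimes U_k$ over $\mathbb{F}$ is the smallest $r$ such that $t$ is a sum of $r$ simple tensors $u_1\otimes\cdots\otimes u_k$. The tensor power $W_k^{\otimes n}$ is regarded as a $kn$-tensor in $(\mathbb{F}^2)^{\otimes kn}$ (no factors are grouped). *)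

(* Defs.v *)
From mathcomp Require Import all_boot all_order all_algebra.
From mathcomp Require Import boolp classical_sets.

Set Implicit Arguments.
Unset Strict Implicit.
Unset Printing Implicit Defensive.

Import GRing.Theory.
Local Open Scope ring_scope.

(* [(F^d)^{\otimes k}] in coordinates: the value of [t] at [j] is the
   coefficient of [b_(j 0) \otimes ... \otimes b_(j k.-1)].  Basis vectors are
   numbered from 0, so the vectors [b_1, b_2] of [F^2] have indices 0, 1. *)
Notation tensor F d k := {ffun {ffun 'I_k -> 'I_d} -> F}.

Definition simple_tensor (F : fieldType) (d k : nat) (u : 'I_k -> 'rV[F]_d) :
    tensor F d k :=
  [ffun j : {ffun 'I_k -> 'I_d} => \prod_(i < k) u i 0 (j i)].

Definition sum_of_simple (F : fieldType) (d k : nat) (t : tensor F d k)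
    (r : nat) : Prop :=
  exists u : 'I_r -> 'I_k -> 'rV[F]_d,
    t = \sum_(s < r) simple_tensor (u s).

Definition is_tensor_rank (F : fieldType) (d k : nat) (t : tensor F d k)
    (r : nat) : Prop :=
  sum_of_simple t r /\ forall s : nat, sum_of_simple t s -> (r <= s)%N.

(* The default value 0 is never used when [0 < k], see [tensor_rankP].  For
   [k = 0] the only simple tensor is the scalar 1, and not every scalar is a
   sum of 1s. *)
Definition tensor_rank (F : fieldType) (d k : nat) (t : tensor F d k) : nat :=
  xget 0%N (is_tensor_rank t).

(* Factor [i] of copy [a] of [t] is factor [mxvec_index a i] of the power:
   the [n * k] factors are kept separate. *)
Definition tensor_pow (F : fieldType) (d k : nat) (t : tensor F d k)
    (n : nat) : tensor F d (n * k) :=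
  [ffun j : {ffun 'I_(n * k) -> 'I_d} =>
     \prod_(a < n) t [ffun i : 'I_k => j (mxvec_index a i)]].

Definition W (F : fieldType) (k : nat) : tensor F 2 k :=
  \sum_(j : {ffun 'I_k -> 'I_2} | #|[pred i | j i == 1]| == 1%N)
    simple_tensor (fun i => delta_mx 0 (j i)).

(* [N <= |F|], where [F] may be infinite. *)
Definition card_at_least (F : fieldType) (N : nat) : Prop :=
  exists s : seq F, uniq s /\ (N <= size s)%N.

Lemma sum_of_simple_exists (F : fieldType) (d k : nat) (t : tensor F d k) :
  (0 < k)%N -> exists r : nat, sum_of_simple t r.
Proof.
case: k t => // k t _.
pose T := {ffun 'I_k.+1 -> 'I_d}.
pose v (j : T) (i : 'I_k.+1) : 'rV[F]_d :=
  (if i == ord0 then t j else 1) *: delta_mx 0 (j i).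
exists #|T|; exists (fun s => v (enum_val s)).
apply/ffunP => l; rewrite sum_ffunE.
rewrite -(big_enum_val (fun j => simple_tensor (v j) l)) /=.
rewrite (bigD1 l) //= big1 ?addr0 => [|j jl]; rewrite ffunE.
  rewrite big_ord_recl big1 => [|i _]; rewrite /v !mxE !eqxx /= ?mulr1 //.
have [i ji] : exists i, j i != l i.
  apply/existsP; apply: contraR jl; rewrite negb_exists => /forallP jl.
  by apply/eqP/ffunP => i; apply/eqP; move: (jl i); rewrite negbK.
by rewrite (bigD1 i) //= !mxE [l i == _]eq_sym (negPf ji) andbF mulr0 mul0r.
Qed.

Lemma tensor_rankP (F : fieldType) (d k : nat) (t : tensor F d k) :
  (0 < k)%N -> is_tensor_rank t (tensor_rank t).
Proof.
move=> k_gt0; have [r tr] := sum_of_simple_exists t k_gt0.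
have ex : exists r, `[< sum_of_simple t r >] by exists r; apply/asboolP.
apply: (@xgetPex _ 0%N (is_tensor_rank t)).
case: (ex_minnP ex) => m /asboolP tm m_min; exists m; split=> // s ts.
by apply: m_min; apply/asboolP.
Qed.

(* Main.v *)
Require Import Defs.
From mathcomp Require Import all_boot all_order all_algebra.
From mathcomp Require Import zify ring.

(** The key is that the border rank of [W_k] is only 2:
<<
      (b_1 + x b_2)^{\otimes k} - b_1^{\otimes k} = x W_k + O(x^2).
>>
    The [m]-th tensor power of the left-hand side is a sum of [2 ^ m] simple
    tensors for every scalar [x]; as a polynomial in [x] it is divisible by
    [x ^ m], has degree at most [m k], and its coefficient of [x ^ m] is
    [W_k^{\otimes m}].  That coefficient is a linear combination of the values
    of the polynomial at [m (k - 1) + 1] distinct nonzero scalars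
    ([coef_extraction_weights]), whence the bound
    [R(W_k^{\otimes m}) <= (m (k - 1) + 1) 2 ^ m] ([sum_of_simple_W_pow]) as
    soon as the field has that many nonzero elements.

    On the other hand [R(W_k) >= k] over every field ([tensor_rank_W_ge]), and
    [2 ^ m] times a linear function of [m] is eventually smaller than [k ^ m].
    In fact [m = 7] works for every [k >= 3], and already [m = 2] for [k = 8].
    Submultiplicativity of the rank ([sum_of_simple_powD]) carries the strict
    inequality from [m] to all [n >= m]; this is why the size required of the
    field does not depend on [n]. *)

Set Implicit Arguments.
Unset Strict Implicit.
Unset Printing Implicit Defensive.

Import GRing.Theory.
Local Open Scope ring_scope.

(** * Decompositions into simple tensors *)

Lemma tensor_rank_le (F : fieldType) (d k : nat) (t : tensor F d k) (r : nat) :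
  (0 < k)%N -> sum_of_simple t r -> (tensor_rank t <= r)%N.
Proof. by move=> k_gt0 tr; apply: (tensor_rankP t k_gt0).2. Qed.

Lemma sum_of_simple_card (F : fieldType) (d k : nat) (t : tensor F d k)
    (I : finType) (u : I -> 'I_k -> 'rV[F]_d) :
  t = \sum_s simple_tensor (u s) -> sum_of_simple t #|I|.
Proof.
move=> ->; exists (fun s => u (enum_val s)).
by rewrite (big_enum_val (fun s => simple_tensor (u s))).
Qed.

(** A scalar can be absorbed into the first factor only if there is one. *)
Lemma sum_of_simple_scaled (F : fieldType) (d k : nat) (t : tensor F d k)
    (I : finType) (c : I -> F) (u : I -> 'I_k -> 'rV[F]_d) :
    (0 < k)%N -> (forall j, t j = \sum_s c s * simple_tensor (u s) j) ->
  sum_of_simple t #|I|.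
Proof.
case: k t u => // k t u _ tE.
apply: (@sum_of_simple_card _ _ _ _ I
  (fun s i => if i == ord0 then c s *: u s i else u s i)).
apply/ffunP => j; rewrite tE sum_ffunE; apply: eq_bigr => s _.
rewrite !ffunE !big_ord_recl /= mxE mulrA.
by congr (_ * _); apply: eq_bigr.
Qed.

(** * Tensor powers *)

Lemma prod_mxvec_index (F : fieldType) (n k : nat) (f : 'I_(n * k) -> F) :
  \prod_i f i = \prod_(a < n) \prod_(i < k) f (mxvec_index a i).
Proof.
rewrite (reindex _ (curry_mxvec_bij n k)) /=.
by rewrite pair_bigA; apply: eq_bigr => -[].
Qed.

(** Going through the matrix of values of [f] avoids inverting [mxvec_index]
    explicitly. *)
Definition unflatten (T : Type) (n k : nat) (f : 'I_n -> 'I_k -> T) :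
    'I_(n * k) -> T :=
  mxvec (\matrix_(a, i) f a i) 0.

Lemma unflattenE (T : Type) (n k : nat) (f : 'I_n -> 'I_k -> T) a i :
  unflatten f (mxvec_index a i) = f a i.
Proof. by rewrite /unflatten mxvecE mxE. Qed.

Lemma eq_tensor_blocks (F : fieldType) (d k n : nat)
    (t t' : tensor F d (n * k)) :
    (forall j : 'I_n -> {ffun 'I_k -> 'I_d},
       t (finfun (unflatten j)) = t' (finfun (unflatten j))) -> t = t'.
Proof.
move=> tt'; apply/ffunP => j.
have := tt' (fun a => [ffun i => j (mxvec_index a i)]).
suff -> : finfun (unflatten (fun a => [ffun i => j (mxvec_index a i)])) = j.
  by [].
by apply/ffunP => l; rewrite ffunE; case/mxvec_indexP: l => a i;
  rewrite unflattenE ffunE.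
Qed.

Lemma tensor_pow_blocks (F : fieldType) (d k n : nat) (t : tensor F d k)
    (j : 'I_n -> {ffun 'I_k -> 'I_d}) :
  tensor_pow t n (finfun (unflatten j)) = \prod_a t (j a).
Proof.
rewrite ffunE; apply: eq_bigr => a _; congr (t _).
by apply/ffunP => i; rewrite !ffunE unflattenE.
Qed.

Lemma simple_tensor_blocks (F : fieldType) (d k n : nat)
    (u : 'I_(n * k) -> 'rV[F]_d) (j : 'I_n -> {ffun 'I_k -> 'I_d}) :
  simple_tensor u (finfun (unflatten j)) =
  \prod_a simple_tensor (fun i => u (mxvec_index a i)) (j a).
Proof.
rewrite ffunE prod_mxvec_index; apply: eq_bigr => a _.
by rewrite ffunE; apply: eq_bigr => i _; rewrite ffunE unflattenE.
Qed.

Lemma sum_of_simple_powD (F : fieldType) (d k m n : nat) (t : tensor F d k)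
    (r s : nat) :
    sum_of_simple (tensor_pow t m) r -> sum_of_simple (tensor_pow t n) s ->
  sum_of_simple (tensor_pow t (m + n)) (r * s).
Proof.
move=> [u tu] [v tv]; rewrite -[r]card_ord -[s]card_ord -card_prod.
pose w (p : 'I_r * 'I_s) := unflatten (fun a i => match split a with
  | inl b => u p.1 (mxvec_index b i) | inr b => v p.2 (mxvec_index b i) end).
apply: (@sum_of_simple_card _ _ _ _ _ w); apply: eq_tensor_blocks => j.
rewrite tensor_pow_blocks big_split_ord /=.
rewrite -!tensor_pow_blocks tu tv !sum_ffunE big_distrlr /= pair_bigA /=.
apply: eq_bigr => p _; rewrite !simple_tensor_blocks big_split_ord /=.
congr (_ * _); apply: eq_bigr => b _; rewrite !ffunE; apply: eq_bigr => i _;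
  rewrite /w unflattenE; case: splitP => c /= E.
- by congr (u _ (mxvec_index _ i) _ _); apply: val_inj.
- by have := ltn_ord b; lia.
- by have := ltn_ord c; lia.
- by congr (v _ (mxvec_index _ i) _ _); apply: val_inj => /=; lia.
Qed.

Lemma sum_of_simple_pow (F : fieldType) (d k : nat) (t : tensor F d k)
    (r n : nat) :
  sum_of_simple t r -> sum_of_simple (tensor_pow t n) (r ^ n).
Proof.
move=> [u tu].
have t1 : sum_of_simple (tensor_pow t 1) r.
  exists (fun s => unflatten (fun _ => u s)); apply: eq_tensor_blocks => j.
  rewrite tensor_pow_blocks big_ord1 tu !sum_ffunE.
  apply: eq_bigr => s _; rewrite simple_tensor_blocks big_ord1.
  by rewrite !ffunE; apply: eq_bigr => i _; rewrite unflattenE.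
elim: n => [|n IHn]; last by rewrite expnS; apply: (sum_of_simple_powD t1 IHn).
exists (fun _ _ => 0); apply: eq_tensor_blocks => j.
by rewrite tensor_pow_blocks big_ord0 big_ord1 simple_tensor_blocks big_ord0.
Qed.

(** * The tensor W and the lower bound on its rank *)

Lemma card_ones (k : nat) (j : {ffun 'I_k -> 'I_2}) :
  #|[pred i | j i == 1]| = (\sum_i j i)%N.
Proof.
rewrite -sum1_card big_mkcond /=; apply: eq_bigr => i _; rewrite inE.
by case: (j i) => -[|[|]].
Qed.

Lemma WE (F : fieldType) (k : nat) (j : {ffun 'I_k -> 'I_2}) :
  W F k j = (\sum_i j i == 1)%N%:R.
Proof.
rewrite /W sum_ffunE -card_ones.
have simpleE (l : {ffun 'I_k -> 'I_2}) :
    simple_tensor (fun i => delta_mx 0 (l i)) j = (j == l)%:R :> F.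
  rewrite ffunE; have [<-|jl] := eqVneq.
    by rewrite big1 // => i _; rewrite mxE !eqxx.
  have /existsP[i ji] : [exists i, j i != l i].
    apply: contraR jl; rewrite negb_exists => /forallP jl.
    by apply/eqP/ffunP => i; apply/eqP; rewrite -[_ == _]negbK jl.
  by rewrite (bigD1 i) //= mxE eqxx (negPf ji) mul0r.
rewrite big_mkcond (bigD1 j) //= big1 => [|l lj]; rewrite simpleE.
  by rewrite eqxx addr0; case: ifP.
by rewrite [j == l]eq_sym (negPf lj); case: ifP.
Qed.

Definition ffcons (k : nat) (T : Type) (x : T) (j : {ffun 'I_k -> T}) :
    {ffun 'I_k.+1 -> T} :=
  [ffun i => if unlift ord0 i is Some i' then j i' else x].

Lemma ffcons0 k T x (j : {ffun 'I_k -> T}) : ffcons x j ord0 = x.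
Proof. by rewrite ffunE unlift_none. Qed.

Lemma ffconsS k T x (j : {ffun 'I_k -> T}) i : ffcons x j (lift ord0 i) = j i.
Proof. by rewrite ffunE liftK. Qed.

(** The substitution method: contracting the first factor with a functional
    [phi] such that [phi b_1 = 1] turns [W_{k+1} + c b_1^{\otimes k+1}] into
    [W_k + (c + phi b_2) b_1^{\otimes k}], so the class of tensors
    [W_k + c b_1^{\otimes k}] is stable under such contractions.  Some summand
    has a first factor outside the line of [b_1], since [b_2] occurs in the
    first factor of [W_{k+1}]; hence [phi] can be chosen to kill that summand,
    and the number of summands drops with [k].  The coefficients [a] collect
    the scalars produced by the contractions, which have no factor left to be
    absorbed in when [k = 0]. *)
Lemma sum_of_simple_W_ge (F : fieldType) (k r : nat) (c : F) (a : 'I_r -> F)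
    (u : 'I_r -> 'I_k -> 'rV[F]_2) :
    (forall j : {ffun 'I_k -> 'I_2},
       \sum_s a s * \prod_i u s i 0 (j i)
       = (\sum_i j i == 1)%N%:R + c * (\sum_i j i == 0)%N%:R) ->
  (k <= r)%N.
Proof.
elim: k r c a u => // k IHk r c a u uE.
have {}uE (x : 'I_2) (j : {ffun 'I_k -> 'I_2}) :
    \sum_s a s * (u s ord0 0 x * \prod_i u s (lift ord0 i) 0 (j i))
    = (x + \sum_i j i == 1)%N%:R + c * (x + \sum_i j i == 0)%N%:R.
  have := uE (ffcons x j); rewrite big_ord_recl ffcons0.
  rewrite (eq_bigr (fun i => j i : nat)) => [<-|i _]; last by rewrite ffconsS.
  apply: eq_bigr => s _; rewrite big_ord_recl ffcons0.
  by under [in RHS]eq_bigr do rewrite ffconsS.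
have [s us] : exists s, u s ord0 0 1 != 0.
  apply/existsP; apply: contraT; rewrite negb_exists => /forallP u0.
  have := uE 1 [ffun=> 0]; rewrite !big1 => [|i _|s _]; last 2 first.
  - by rewrite ffunE.
  - by have := u0 s; rewrite negbK => /eqP ->; rewrite mul0r mulr0.
  by rewrite /= mulr0 addr0 => /eqP; rewrite eq_sym oner_eq0.
case: r a u uE s us => [|r] a u uE s us; first by case: s us.
(* [phi b_2], determined by [phi (u s ord0) = 0] *)
pose p := - (u s ord0 0 0 / u s ord0 0 1).
rewrite ltnS; apply: (IHk r (c + p)
  (fun l => a (lift s l) * (u (lift s l) ord0 0 0 + p * u (lift s l) ord0 0 1))
  (fun l i => u (lift s l) (lift ord0 i))) => j.
transitivity (\sum_s a s * (u s ord0 0 0 * \prod_i u s (lift ord0 i) 0 (j i)) +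
  p * \sum_s a s * (u s ord0 0 1 * \prod_i u s (lift ord0 i) 0 (j i))).
  rewrite mulr_sumr -big_split /= (bigD1_ord s) //= -[LHS]add0r; congr (_ + _).
    by rewrite /p; field.
  by apply: eq_bigr => l _; ring.
by rewrite !uE /= add0n add1n eqSS /=; ring.
Qed.

Lemma tensor_rank_W_ge (F : fieldType) (k : nat) :
  (0 < k)%N -> (k <= tensor_rank (W F k))%N.
Proof.
move=> k_gt0; have [[u uE] _] := tensor_rankP (W F k) k_gt0.
apply: (@sum_of_simple_W_ge F k _ 0 (fun=> 1) u) => j.
rewrite mul0r addr0 -WE [RHS](congr1 (fun t : tensor F 2 k => t j) uE).
rewrite sum_ffunE.
by apply: eq_bigr => s _; rewrite mul1r ffunE.
Qed.

(** * The interpolation upper bound *)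

(** Dividing by [X ^ m] reduces the claim to extracting the constant
    coefficient of a polynomial of degree at most [d], and the weights for that
    solve a Vandermonde system. *)
Lemma coef_extraction_weights (F : fieldType) (m d : nat) (x : 'I_d.+1 -> F) :
    injective x -> (forall l, x l != 0) ->
  exists w : 'I_d.+1 -> F, forall e, (m <= e <= m + d)%N ->
    \sum_l w l * x l ^+ e = (e == m)%:R.
Proof.
move=> x_inj x_neq0; pose V := Vandermonde d.+1 (\row_l x l).
have V_unit : V \in unitmx.
  rewrite unitmxE det_Vandermonde unitfE; apply/prodf_neq0 => i _.
  apply/prodf_neq0 => j ij; rewrite !mxE subr_eq0 (inj_eq x_inj).
  by rewrite neq_ltn ij orbT.
pose w : 'cV_d.+1 := invmx V *m delta_mx 0 0.
have wE : V *m w = delta_mx 0 0 by rewrite mulKVmx.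
exists (fun l => w l 0 / x l ^+ m) => e /andP[me ed].
have ltd : (e - m < d.+1)%N by lia.
have := congr1 (fun A : 'cV_d.+1 => A (Ordinal ltd) 0) wE.
rewrite !mxE eqxx andbT.
have -> : (Ordinal ltd == 0) = (e == m).
  by apply/eqP/eqP => [/(congr1 val) /= | em]; last apply/val_inj => /=; lia.
move=> <-; apply: eq_bigr => l _; rewrite !mxE /= expfB_cond ?me //.
- by rewrite mulrC mulrA; ring.
- by rewrite (negPf (x_neq0 l)).
Qed.

Lemma nonzero_points (F : fieldType) (n : nat) :
    card_at_least F n.+1 ->
  exists x : 'I_n -> F, injective x /\ forall l, x l != 0.
Proof.
move=> [s [s_uniq s_size]]; pose s' := [seq y <- s | y != 0].
have s'_size : (n <= size s')%N.
  rewrite size_filter -ltnS; apply: leq_trans s_size _.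
  rewrite -(count_predC (pred1 0)) count_uniq_mem // -add1n leq_add2r.
  exact: leq_b1.
have lt_s' (l : 'I_n) : (l < size s')%N by apply: leq_trans s'_size.
exists (fun l => s'`_l); split=> [l1 l2 /eqP|l].
  by rewrite nth_uniq ?filter_uniq // => /eqP /val_inj.
by have := mem_nth 0 (lt_s' l); rewrite mem_filter => /andP[].
Qed.

(** The vector [b_1 + x b_2] or [b_1] according to [f], both written as
    [b_1 + y b_2]; the convention [0 ^+ 0 = 1] covers the case [y = 0]. *)
Definition approx_vector (F : fieldType) (x : F) (f : bool) : 'rV[F]_2 :=
  \row_(i < 2) (if f then x else 0) ^+ i.

Lemma simple_approx (F : fieldType) (k : nat) (x : F) (f : bool)
    (j : {ffun 'I_k -> 'I_2}) :
  simple_tensor (fun=> approx_vector x f) j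
  = (if f then x else 0) ^+ (\sum_i j i)%N.
Proof. by rewrite ffunE expr_sum; apply: eq_bigr => i _; rewrite mxE. Qed.

(** In coordinates the [m]-th power of the approximation vanishes at a
    multi-index in which some block has weight 0, and elsewhere equals [x]
    raised to the total weight, a number between [m] and [m k].  The weight
    [m] is reached exactly when every block has weight 1, that is, on the
    support of [W_k^{\otimes m}]. *)
Lemma sum_of_simple_W_pow (F : fieldType) (k m : nat) :
    (0 < k)%N -> (0 < m)%N -> card_at_least F (m * k.-1).+2 ->
  sum_of_simple (tensor_pow (W F k) m) ((m * k.-1).+1 * 2 ^ m).
Proof.
move=> k_gt0 m_gt0 /nonzero_points[x [x_inj x_neq0]].
have [w wE] := coef_extraction_weights m x_inj x_neq0.
set d := (m * k.-1)%N in x x_inj x_neq0 w wE *.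
pose I := ('I_d.+1 * {ffun 'I_m -> bool})%type.
have <- : #|{: I}| = (d.+1 * 2 ^ m)%N.
  by rewrite card_prod card_ffun card_bool !card_ord.
pose c (s : I) := w s.1 * \prod_(a < m) (if s.2 a then 1 else -1).
pose u (s : I) := unflatten (fun a (_ : 'I_k) => approx_vector (x s.1) (s.2 a)).
apply: (@sum_of_simple_scaled _ _ _ _ _ c u); first by rewrite muln_gt0 m_gt0.
suff uE : tensor_pow (W F k) m = [ffun j => \sum_s c s * simple_tensor (u s) j].
  by move=> j; rewrite {1}uE ffunE.
apply: eq_tensor_blocks => j; rewrite tensor_pow_blocks [RHS]ffunE.
pose n_ a := (\sum_i j a i)%N.
have blockE l : \sum_(f : {ffun 'I_m -> bool})
    c (l, f) * simple_tensor (u (l, f)) (finfun (unflatten j))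
    = w l * \prod_a (x l ^+ n_ a - 0 ^+ n_ a).
  transitivity (w l * \sum_(f : {ffun 'I_m -> bool}) \prod_a
      ((if f a then 1 else -1) * (if f a then x l else 0) ^+ n_ a)).
    rewrite mulr_sumr; apply: eq_bigr => f _.
    rewrite /c /= -mulrA; congr (_ * _).
    rewrite simple_tensor_blocks -big_split; apply: eq_bigr => a _ /=.
    congr (_ * _); rewrite -simple_approx !ffunE; apply: eq_bigr => i _.
    by rewrite /u unflattenE.
  rewrite -(bigA_distr_bigA (fun a (b : bool) =>
    (if b then 1 else -1) * (if b then x l else 0) ^+ n_ a)).
  congr (_ * _); apply: eq_bigr => a _.
  by rewrite big_bool /= mul1r mulN1r.
rewrite -(pair_bigA _ (fun l f =>
  c (l, f) * simple_tensor (u (l, f)) (finfun (unflatten j)))) /=.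
rewrite (eq_bigr _ (fun l _ => blockE l)).
have [[a na0]|n_gt0] : (exists a, n_ a = 0%N) \/ forall a, (0 < n_ a)%N.
  have [/existsP[a /eqP]|] := boolP [exists a, n_ a == 0%N].
    by left; exists a.
  by rewrite negb_exists => /forallP n0; right=> a; rewrite lt0n n0.
  rewrite (bigD1 a) //= WE -/(n_ a) na0 mul0r big1 // => l _.
  by rewrite (bigD1 a) //= na0 !expr0 subrr mul0r mulr0.
have sum_ge : (m <= \sum_a n_ a)%N.
  by rewrite -[m in (m <= _)%N]card_ord -sum1_card; apply: leq_sum.
have sum_le : (\sum_a n_ a <= m + d)%N.
  have -> : (m + d = \sum_(a < m) k)%N.
    by rewrite sum_nat_const card_ord /d -mulnS prednK.
  apply: leq_sum => a _.
  rewrite -[leqRHS]card_ord -sum1_card; apply: leq_sum => i _.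
  by rewrite -ltnS.
transitivity (\sum_l w l * x l ^+ (\sum_a n_ a)%N); last first.
  apply: eq_bigr => l _; rewrite expr_sum; congr (_ * _); apply: eq_bigr => a _.
  by rewrite [0 ^+ _]expr0n eqn0Ngt n_gt0 subr0.
rewrite wE ?sum_ge //.
have [all1|] := boolP [forall a, n_ a == 1%N].
  rewrite big1 => [|a _]; last by rewrite WE -/(n_ a) (forallP all1).
  rewrite (eq_bigr (fun=> 1%N)) => [|a _]; last exact/eqP/(forallP all1).
  by rewrite sum1_card card_ord eqxx.
rewrite negb_forall => /existsP[a na1].
rewrite (bigD1 a) //= WE -/(n_ a) (negPf na1) mul0r; suff : (m < \sum_a n_ a)%N.
  by move=> lt_m; rewrite gtn_eqF.
rewrite -[m in (m < _)%N]card_ord -sum1_card (bigD1 a) //=.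
rewrite [ltnRHS](bigD1 a) //=.
rewrite -addSn leq_add //; last exact: leq_sum.
by rewrite ltn_neqAle eq_sym na1 n_gt0.
Qed.

(** * Strict submultiplicativity *)

Lemma tensor_rank_W_pow_lt (F : fieldType) (k m n : nat) :
    (0 < k)%N -> (0 < m <= n)%N -> ((m * k.-1).+1 * 2 ^ m < k ^ m)%N ->
    card_at_least F (m * k.-1).+2 ->
  (tensor_rank (tensor_pow (W F k) n) < tensor_rank (W F k) ^ n)%N.
Proof.
move=> k_gt0 /andP[m_gt0 mn] lt_m cardF.
have rank_ge := tensor_rank_W_ge F k_gt0.
have [Wr _] := tensor_rankP (W F k) k_gt0.
have := sum_of_simple_powD (sum_of_simple_W_pow k_gt0 m_gt0 cardF)
                           (sum_of_simple_pow (n - m) Wr).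
rewrite subnKC // => Wn.
apply: leq_ltn_trans (tensor_rank_le _ Wn) _.
  by rewrite muln_gt0 k_gt0 (leq_trans m_gt0).
rewrite -[in ltnRHS](subnKC mn) expnD ltn_pmul2r.
  by apply: leq_trans lt_m _; rewrite leq_exp2r.
by rewrite expn_gt0 (leq_trans k_gt0).
Qed.

Lemma seventh_power_bound (k : nat) :
  (3 <= k)%N -> ((7 * k.-1).+1 * 2 ^ 7 < k ^ 7)%N.
Proof.
rewrite leq_eqVlt => /predU1P[<- | k_ge4]; first by vm_compute.
have : (4 ^ 6 <= k ^ 6)%N by rewrite leq_exp2r.
rewrite [(k ^ 7)%N]expnS; have -> : (4 ^ 6 = 4096)%N by [].
have -> : (2 ^ 7 = 128)%N by [].
move: (k ^ 6)%N => y; nia.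
Qed.

Local Close Scope ring_scope.

Theorem proposition13 :
  (forall k : nat, 3 <= k ->
     exists N n0 : nat,
       forall F : fieldType, card_at_least F N ->
       forall n : nat, n0 <= n ->
         tensor_rank (tensor_pow (W F k) n) < tensor_rank (W F k) ^ n)
  /\
  (exists N : nat,
     forall F : fieldType, card_at_least F N ->
       tensor_rank (tensor_pow (W F 3) 7) < tensor_rank (W F 3) ^ 7
       /\ tensor_rank (tensor_pow (W F 8) 2) < tensor_rank (W F 8) ^ 2).
Proof.
split=> [k k_ge3|].
  exists (7 * k.-1).+2, 7 => F cardF n n_ge7.
  apply: (tensor_rank_W_pow_lt _ _ (seventh_power_bound k_ge3)) => //.
  exact: leq_trans k_ge3.
(* [k = 3, m = 7] and [k = 8, m = 2] both need [m (k - 1) + 1] nonzero points,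
   which is 15 in either case *)
exists 16 => F cardF; split.
  exact: (tensor_rank_W_pow_lt _ _ (seventh_power_bound (leqnn 3))).
by apply: (@tensor_rank_W_pow_lt F 8 2 2).
Qed.
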